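(* Suppose $(X, \tau, <)$ is a GO-space that is monotonically countably metacompact. Then $(X, \tau)$ is hereditarily paracompact.
   Context: A GO-space (generalized ordered space) is a triple $(X, \tau, <)$ where $<$ is a linear ordering of the set $X$ and $\tau$ is a Hausdorff topology on $X$ that has a base of convex subsets of $(X,<)$, possibly including some singletons. For two collections of sets $\mathcal{U}$ and $\mathcal{V}$, write $\mathcal{U} \prec \mathcal{V}$ if for each $U \in \mathcal{U}$ there is some $V \in \mathcal{V}$ with $U \subseteq V$. A space $X$ is monotonically countably metacompact (in the sense of Popvassilev) if there is a function $r$ that associates with each countable open cover $\mathcal{U}$ of $X$ a point-finite collection $r(\mathcal{U})$ of open sets that covers $X$ and satisfies $r(\mathcal{U}) \prec \mathcal{U}$, in such a way that if $\mathcal{U}$ and $\mathcal{V}$ are countable open covers of $X$ with $\mathcal{U} \prec \mathcal{V}$, then $r(\mathcal{U}) \prec r(\mathcal{V})$. (The collection $r(\mathcal{U})$ is not required to be countable.) *)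

(* Defs.v *)
From mathcomp Require Import all_boot all_order.
From mathcomp Require Import all_classical topology.

Set Implicit Arguments.
Unset Strict Implicit.
Unset Printing Implicit Defensive.

Local Open Scope order_scope.
Local Open Scope classical_set_scope.

Definition order_convex d (T : porderType d) (A : set T) : Prop :=
  forall x y z, A x -> A y -> x <= z <= y -> A z.

(* The topology is not required to be the order topology of <=, only to have a
   convex base: unlike in orderTopologicalType, it may be strictly finer
   (Sorgenfrey line, discrete topologies). *)
Definition GO_space d (T : POrderedTopological.type d) : Prop :=
  [/\ total (<=%O : rel T), hausdorff_space T &
      exists2 B : set (set T), basis B & B `<=` @order_convex d T].

Definition refines (T : Type) (U V : set (set T)) : Prop :=
  forall A, U A -> exists2 B, V B & A `<=` B.

Definition open_cover (T : topologicalType) (U : set (set T)) : Prop :=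
  U `<=` open /\ cover U id = [set: T].

Definition point_finite (T : Type) (U : set (set T)) : Prop :=
  forall x, finite_set [set A | U A /\ A x].

Definition locally_finite (T : topologicalType) (U : set (set T)) : Prop :=
  forall x : T, exists2 W, nbhs x W & finite_set [set A | U A /\ A `&` W !=set0].

(* The values of r outside the countable open covers are irrelevant, so r is
   taken to be total. *)
Definition monotonically_countably_metacompact (T : topologicalType) : Prop :=
  exists r : set (set T) -> set (set T),
    (forall U, countable U -> open_cover U ->
       [/\ open_cover (r U), point_finite (r U) & refines (r U) U]) /\
    (forall U V, countable U -> open_cover U -> countable V -> open_cover V ->
       refines U V -> refines (r U) (r V)).

Definition paracompact (T : topologicalType) : Prop :=
  hausdorff_space T /\
  forall U : set (set T), open_cover U ->
    exists V, [/\ open_cover V, locally_finite V & refines V U].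

(* [set_type A] carries the subspace topology of A. In contrast, [subspace A]
   is a topology on the whole of T, making the complement of A discrete. *)
Definition hereditarily_paracompact (T : topologicalType) : Prop :=
  forall A : set T, paracompact (set_type A).

(* Main.v *)
(* For b < b', monotonicity of r bounds how far the members of
   r {(<-, b'), (b, ->)} can reach. Give every point a of a set K without
   maximum a neighbourhood N_a inside such a member, with a < b and N_a < b.
   If the N_a containing some point q were unbounded in K, choose b_n < b'_n
   and points of the corresponding N_a above b'_(n-1), and let U be the union of
   the covers {(<-, b'_n), (b_n, ->)}. Each of them refines U, so their
   r-members through q lie in members of r U through q. There are finitely many
   of these, each below some b'_j, a contradiction. Hence the stars of the
   neighbourhood assignment N are bounded in K.
   Given a cover of a subspace by convex open sets, apply this in both
   directions to each class K of points joined by intervals that finitely many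
   members cover. Then every iterated star of a point lies in such an interval, and a
   cover whose iterated stars are each covered by finitely many members of U
   yields a locally finite refinement of U, layer by layer. *)

Require Import Defs.
From mathcomp Require Import all_boot all_order.
From mathcomp Require Import all_classical topology.

Set Implicit Arguments.
Unset Strict Implicit.
Unset Printing Implicit Defensive.

Import Order.TTheory.

Local Open Scope classical_set_scope.

(** * Bounded stars from monotone countable metacompactness *)

Definition ray_pair (T : Type) (lt : T -> T -> Prop) (b b' : T) : set (set T) :=
  [set [set x | lt x b']; [set x | lt b x]].

Lemma ray_pair_cover (T : topologicalType) (lt : T -> T -> Prop) (b b' : T) :
  (forall x y z, lt x z -> lt x y \/ lt y z) ->
  (forall b, open [set x | lt x b]) -> (forall b, open [set x | lt b x]) ->
  lt b b' -> open_cover (ray_pair lt b b').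
Proof.
move=> lt_tot ltO gtO bb'; split; first by move=> _ [|] ->.
apply/seteqP; split=> // x _.
by case: (lt_tot _ x _ bb') => ?;
  [exists [set x | lt b x]; [right|]|exists [set x | lt x b']; [left|]].
Qed.

(** The order is an abstract [lt] so that the result serves for both [<] and [>]; comparing every
    point with [b] and [b'] makes each [ray_pair] a cover. *)
Lemma bounded_star (T : topologicalType) (lt : T -> T -> Prop) (K : set T) :
  monotonically_countably_metacompact T ->
  (forall x, ~ lt x x) -> (forall x y z, lt x y -> lt y z -> lt x z) ->
  (forall x y z, lt x z -> lt x y \/ lt y z) ->
  (forall b, open [set x | lt x b]) -> (forall b, open [set x | lt b x]) ->
  exists N : T -> set T,
    (forall a, K a -> open_nbhs a (N a)) /\
    forall q, K q -> exists2 u, K u &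
      forall a y, K a -> N a q -> K y -> N a y -> ~ lt u y.
Proof.
move=> [r [rP rM]] irr trans lt_tot ltO gtO.
have pairP b b' : lt b b' ->
    countable (ray_pair lt b b') /\ open_cover (ray_pair lt b b').
  move=> bb'; split; last exact: ray_pair_cover.
  by apply: finite_set_countable; exact: finite_set2.
have [[m Km mP]|nomax] := pselect (exists2 m, K m & forall y, K y -> ~ lt m y).
  exists (fun=> setT); split=> [a _|q _]; first by split=> //; exact: openT.
  by exists m => // a y _ _ Ky _; exact: mP.
have {nomax} above u : K u -> exists2 y, K y & lt u y.
  move=> Ku; apply: contrapT => noy; apply: nomax; exists u => // y Ky uy.
  by apply: noy; exists y.
(* The triple [p] packs [b], [b'] and a member of [r (ray_pair lt b b')] containing [a]. *)
have choose_N a : exists p : (T * T * set T)%type, K a ->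
    [/\ K p.1.2, lt a p.1.1, lt p.1.1 p.1.2,
        r (ray_pair lt p.1.1 p.1.2) p.2 & p.2 a].
  have [Ka|nKa] := pselect (K a); last by exists (a, a, setT).
  have [b Kb ab] := above _ Ka; have [b' Kb' bb'] := above _ Kb.
  have [cU oU] := pairP _ _ bb'; have [[_ rcov] _ _] := rP _ cU oU.
  have [W rW Wa] : cover (r (ray_pair lt b b')) id a by rewrite rcov.
  by exists (b, b', W).
have {choose_N} [p pP] := boolp.choice choose_N.
exists (fun a => (p a).2 `&` [set x | lt x (p a).1.1]); split=> [a Ka|q Kq].
  have [_ ab bb' rW Wa] := pP a Ka; split=> //; apply: openI => //.
  have [cU oU] := pairP _ _ bb'; have [[rO _] _ _] := rP _ cU oU; exact: rO.
apply: contrapT => unbounded.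
have step u : exists s : (T * T)%type, K u ->
    [/\ K s.1, ((p s.1).2 q /\ lt q (p s.1).1.1), (p s.1).2 s.2,
        lt s.2 (p s.1).1.1 & lt u s.2].
  have [Ku|nKu] := pselect (K u); last by exists (u, u).
  apply: contrapT => nos; apply: unbounded; exists u => //.
  move=> a y Ka [Wq qb] Ky [Wy yb] uy.
  by apply: nos; exists (a, y).
have {step unbounded} [s sP] := boolp.choice step.
(* Start at [q]; [u n.+1] is the [b'] of a point whose neighbourhood contains [q] and some [y n]
   beyond [u n]. Thus [u n], [y n], [b n], [u n.+1] increase. *)
pose u n := iter n (fun u => (p (s u).1).1.2) q.
have uK n : K (u n).
  elim: n => //= n /sP[Ka _ _ _ _].
  by have [] := pP _ Ka.
pose a n := (s (u n)).1; pose y n := (s (u n)).2.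
pose b n := (p (a n)).1.1; pose W n := (p (a n)).2.
have aK n : K (a n) by have [] := sP _ (uK n).
have bu n : lt (b n) (u n.+1) by have [] := pP _ (aK n).
have rW n : r (ray_pair lt (b n) (u n.+1)) (W n) by have [] := pP _ (aK n).
have Wq n : W n q by have [_ []] := sP _ (uK n).
have qb n : lt q (b n) by have [_ []] := sP _ (uK n).
have Wy n : W n (y n) by have [] := sP _ (uK n).
have yb n : lt (y n) (b n) by have [] := sP _ (uK n).
have uy n : lt (u n) (y n) by have [] := sP _ (uK n).
have uS n : lt (u n) (u n.+1).
  exact: trans (uy n) (trans _ _ _ (yb n) (bu n)).
have umono m n : (m < n)%N -> lt (u m) (u n).
  elim: n => // n IHn; rewrite ltnS leq_eqVlt => /orP[/eqP -> //|/IHn mn].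
  exact: trans mn (uS n).
(* Every [ray_pair lt (b n) (u n.+1)] refines [U], but a member of [r U] that
   contains [q] lies below some [u j], so finitely many of them cannot contain
   all the [y n]. *)
pose U := \bigcup_n ray_pair lt (b n) (u n.+1).
have pairU n : ray_pair lt (b n) (u n.+1) `<=` U by move=> A ?; exists n.
have cU : countable U.
  by apply: bigcup_countable => // n _; have [] := pairP _ _ (bu n).
have oU : open_cover U.
  split; first by move=> A [n _ An]; have [_ [+ _]] := pairP _ _ (bu n); apply.
  apply/seteqP; split=> // x _.
  have [_ [_ cov]] := pairP _ _ (bu 0).
  have [A A0 Ax] : cover (ray_pair lt (b 0%N) (u 1%N)) id x by rewrite cov.
  by exists A => //; exact: pairU A0.
have [_ pfU refU] := rP _ cU oU.
(* A member through [q] cannot refine an upper ray, since [q] lies below every [b j]; so it refines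
   a lower ray, which ends at [u j.+1]. *)
have bounded A : exists j, r U A -> A q -> forall x, A x -> lt x (u j).
  have [rA|] := pselect (r U A); last by exists 0.
  have [B [j _ [|]] -> AB] := refU _ rA; first by exists j.+1 => _ _ x /AB.
  by exists 0 => _ /AB qj; case: (irr q); exact: trans (qb j) qj.
have {bounded} [j jP] := boolp.choice bounded.
have /finite_seqP[F FE] := pfU q.
(* For this [n], every member of [r U] through [q] lies below [u n], whereas [W n] contains
   [y n]. *)
pose n := \max_(A <- F) j A.
have [cn on] := pairP _ _ (bu n).
have refn : refines (ray_pair lt (b n) (u n.+1)) U.
  by move=> A /pairU UA; exists A.
have [A rA WA] := rM _ _ cn on cU oU refn _ (rW n).
have AF : A \in F.
  have : [set A | r U A /\ A q] A by split=> //; exact: WA.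
  by rewrite FE.
have yj := jP A rA (WA _ (Wq n)) _ (WA _ (Wy n)).
have : (j A <= n)%N by exact: leq_bigmax_seq.
rewrite leq_eqVlt => /orP[/eqP jn|/umono jn]; apply: (irr (y n)).
  by rewrite jn in yj; exact: trans yj (uy n).
exact: trans yj (trans _ _ _ jn (uy n)).
Qed.

(** * Iterated stars and locally finite refinements *)

Definition star (T : Type) (O : set (set T)) (B : set T) : set T :=
  \bigcup_(o in [set o | O o /\ o `&` B !=set0]) o.

Definition star_ball (T : Type) (O : set (set T)) (n : nat) (x : T) : set T :=
  iter n (star O) [set x].

Definition star_component (T : Type) (O : set (set T)) (x : T) : set T :=
  \bigcup_n star_ball O n x.

Section StarBall.
Variables (T : Type) (O : set (set T)).

Lemma sub_star_ball o n x :
  O o -> o `&` star_ball O n x !=set0 -> o `<=` star_ball O n.+1 x.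
Proof. by move=> Oo ox y oy; exists o. Qed.

Lemma star_ball_trans m n x y z :
  star_ball O n x y -> star_ball O m y z -> star_ball O (m + n) x z.
Proof.
move=> xy; elim: m z => [|m IHm] z; first by move=> ->.
move=> [o [Oo [w [ow yw]]] oz]; rewrite addSn; apply: sub_star_ball oz => //.
by exists w; split=> //; exact: IHm.
Qed.

Lemma star_ball_sym n x y : star_ball O n x y -> star_ball O n y x.
Proof.
elim: n y => [|n IHn] y; first by move=> ->.
move=> [o [Oo [w [ow /IHn xw]]] oy]; rewrite -addn1; apply: star_ball_trans xw.
by apply: (sub_star_ball Oo _ ow); exists y.
Qed.

Lemma star_component_eq x y z :
  star_component O x z -> star_component O y z ->
  star_component O x = star_component O y.
Proof.
wlog suff sub : x y / star_component O x z -> star_component O y z ->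
    star_component O x `<=` star_component O y.
  by move=> xz yz; apply/seteqP; split; exact: sub.
move=> [m _ xz] [n _ yz] w [k _ xw]; exists (k + (m + n))%N => //.
apply: star_ball_trans xw; apply: star_ball_trans yz _; exact: star_ball_sym.
Qed.

End StarBall.

(** Sort the members of [O] in a component by the first ball about a fixed centre that they meet.
    Layer [m] lies in ball [m.+1], so finitely many members of [U] cover it; intersecting them with
    the layer gives the refinement. *)
Lemma star_finite_locally_finite_refinement (T : topologicalType)
    (O U : set (set T)) :
  open_cover O -> U `<=` open ->
  (forall n x, exists F, [/\ finite_set F, F `<=` U &
    star_ball O n x `<=` cover F id]) ->
  exists V, [/\ open_cover V, locally_finite V & refines V U].
Proof.
move=> [oO cO] oU finO.
have [F FP] := boolp.choice (fun p : nat * T => finO p.1 p.2).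
(* The default [x] is never returned, as the component contains [x]; hence [c] depends only on the
   component. *)
pose c x := xget x (star_component O x).
have cP x : star_component O x (c x).
  by apply: xgetPex; exists x; exists 0.
have cE x y z : star_component O x z -> star_component O y z -> c x = c y.
  move=> xz yz; rewrite /c (star_component_eq xz yz).
  by rewrite /xget; case: pselect => // -[]; exists z; exact/asboolP.
pose layer x m := \bigcup_(o in [set o | [/\ O o, o `&` star_ball O m x !=set0 &
  forall k, (k < m)%N -> o `&` star_ball O k x = set0]]) o.
have layerS x m : layer x m `<=` star_ball O m.+1 x.
  by move=> y [o [Oo ox _] oy]; exact: sub_star_ball oy.
have layer_open x m : open (layer x m).
  by apply: bigcup_open => o [/oO].
pose V := [set A | exists x m, c x = x /\
  exists2 B, F (m.+1, x) B & A = layer x m `&` B].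
exists V; split.
- split.
    move=> _ [x [m [_ [B FB ->]]]]; apply: openI => //.
    by have [_ FU _] := FP (m.+1, x); exact/oU/FU.
  apply/seteqP; split=> // p _.
  have [n _ pn] := cP p.
  have [o Oo op] : cover O id p by rewrite cO.
  have ex_m : exists m, `[< o `&` star_ball O m (c p) !=set0 >].
    by exists n; apply/asboolP; exists p; split=> //; exact: star_ball_sym.
  case: (ex_minnP ex_m) => m /asboolP om m_min.
  have pm : layer (c p) m p.
    exists o => //; split=> // k km; apply/seteqP; split=> // y oy.
    have /m_min : `[< o `&` star_ball O k (c p) !=set0 >].
      by apply/asboolP; exists y.
    by rewrite leqNgt km.
  have [_ _ covF] := FP (m.+1, c p).
  have [B FB Bp] := covF _ (layerS _ _ _ pm).
  exists (layer (c p) m `&` B) => //; exists (c p), m; split; last by exists B.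
  by apply: (cE _ _ (c p)) => //; exists 0.
- move=> p; have [n _ pn] := cP p.
  have [o Oo op] : cover O id p by rewrite cO.
  exists o; first by apply: open_nbhs_nbhs; split=> //; exact: oO.
  have ocp : o `<=` star_ball O n.+1 (c p).
    by apply: sub_star_ball => //; exists p; split=> //; exact: star_ball_sym.
  (* Since [o] lies in ball [n.+1], it misses layer [m] for every [m > n.+1]. *)
  apply: (@sub_finite_set _ _ (\bigcup_(m in `I_n.+2)
    [set layer (c p) m `&` B | B in F (m.+1, c p)])); last first.
    apply: bigcup_finite => [|m _]; first exact: finite_II.
    by apply: finite_image; have [] := FP (m.+1, c p).
  move=> _ [[x [m [cx [B FB ->]]]] [w [[wxm _] ow]]].
  have xE : x = c p.
    rewrite -cx; apply: (cE _ _ w); first by exists m.+1 => //; exact: layerS.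
    by exists (n.+1 + n)%N => //; apply: star_ball_trans pn _; exact: ocp.
  exists m; last by exists B => //; rewrite -xE.
  rewrite /= ltnNge; apply/negP => nm; have [o' [Oo' _ o'm] o'w] := wxm.
  have : (o' `&` star_ball O n.+1 x) w by split=> //; rewrite xE; exact: ocp.
  by rewrite o'm.
- move=> _ [x [m [_ [B FB ->]]]]; exists B; last by move=> y [].
  by have [_ FU _] := FP (m.+1, x); exact: FU.
Qed.

(** * Finite linkage and bounded star balls in GO-spaces *)

Section GOSpace.
Context {d : Order.disp_t} {X : POrderedTopological.type d}.
Implicit Types (x y z : X) (U : set (set X)).

(** The disjunction covers both orders of the endpoints, which makes the relation symmetric. *)
Definition finitely_linked U x y : Prop :=
  exists F, [/\ finite_set F, F `<=` U &
    forall z, (x <= z <= y)%O || (y <= z <= x)%O -> cover F id z].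

Lemma finitely_linked_sym U x y :
  finitely_linked U x y -> finitely_linked U y x.
Proof.
by move=> [F [fF FU Fxy]]; exists F; split=> // z; rewrite orbC; exact: Fxy.
Qed.

Hypothesis GOX : GO_space X.

Let not_lt_le x y : ~ (x < y)%O -> (y <= x)%O.
Proof.
have [tot _ _] := GOX; move=> /negP; case: comparable_ltgtP => //.
by rewrite /Order.comparable; exact: tot.
Qed.

Lemma finitely_linked_trans U x y z :
  finitely_linked U x y -> finitely_linked U y z -> finitely_linked U x z.
Proof.
have [tot _ _] := GOX.
move=> [F [fF FU Fxy]] [G [fG GU Gyz]]; exists (F `|` G); split.
- by rewrite finite_setU.
- by move=> A [/FU|/GU].
have coverl w : cover F id w -> cover (F `|` G) id w.
  by move=> [B ? ?]; exists B => //; left.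
have coverr w : cover G id w -> cover (F `|` G) id w.
  by move=> [B ? ?]; exists B => //; right.
move=> w /orP[]/andP[]; have /orP[wy|yw] := tot w y.
- by move=> xw _; apply/coverl/Fxy; rewrite xw wy.
- by move=> _ wz; apply/coverr/Gyz; rewrite yw wz.
- by move=> zw _; apply/coverr/Gyz; rewrite zw wy orbT.
- by move=> _ wx; apply/coverl/Fxy; rewrite yw wx orbT.
Qed.

(** Neighbourhoods are chosen per class, the class being passed as a set; linked points must
    therefore give equal sets. *)
Lemma finitely_linked_eq U x y :
  finitely_linked U x y -> finitely_linked U x = finitely_linked U y.
Proof.
move=> xy; apply/predeqP => z; split; last exact: finitely_linked_trans.
by apply: finitely_linked_trans; exact: finitely_linked_sym.
Qed.

Lemma finitely_linked_convex U x y C :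
  U C -> order_convex C -> C x -> C y -> finitely_linked U x y.
Proof.
move=> UC convC Cx Cy; exists [set C]; split; first exact: finite_set1.
  by move=> _ ->.
by move=> z /orP[] xzy; exists C => //; [apply: convC xzy|apply: convC xzy].
Qed.

Lemma GO_convex_nbhs x (A : set X) : nbhs x A ->
  exists C, [/\ open C, order_convex C, C x & C `<=` A].
Proof.
have [_ _ [B [oB Bx] convB]] := GOX.
by move=> /Bx[C [BC Cx] CA]; exists C; split=> //; [exact: oB|exact: convB].
Qed.

Lemma GO_convex_nbhs_neq x y : x <> y ->
  exists C, [/\ open C, order_convex C, C x & ~ C y].
Proof.
have [_ /hausdorff_accessible accX _] := GOX.
move=> /eqP /accX[A [oA]]; rewrite !inE => Ax nAy.
have /GO_convex_nbhs[C [oC convC Cx CA]] : nbhs x A.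
  exact: open_nbhs_nbhs.
by exists C; split=> // /CA.
Qed.

(** A convex neighbourhood of [x < b] that misses [b] cannot reach past [b]. *)
Lemma GO_open_ltr b : open [set x : X | (x < b)%O].
Proof.
rewrite openE => x /= xb; rewrite /interior.
have /GO_convex_nbhs_neq[C [oC convC Cx nCb]] : x <> b.
  by move=> xE; rewrite xE ltxx in xb.
apply: filterS (open_nbhs_nbhs (conj oC Cx)) => y Cy /=.
apply: contrapT => /not_lt_le b_y; apply: nCb; apply: convC Cx Cy _.
by rewrite (ltW xb).
Qed.

Lemma GO_open_gtr b : open [set x : X | (b < x)%O].
Proof.
rewrite openE => x /= bx; rewrite /interior.
have /GO_convex_nbhs_neq[C [oC convC Cx nCb]] : x <> b.
  by move=> xE; rewrite xE ltxx in bx.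
apply: filterS (open_nbhs_nbhs (conj oC Cx)) => y Cy /=.
apply: contrapT => /not_lt_le y_b; apply: nCb; apply: convC Cy Cx _.
by rewrite y_b (ltW bx).
Qed.

(** Intersect the neighbourhoods obtained for the order and for its reverse. *)
Lemma GO_bounded_star (K : set X) :
  monotonically_countably_metacompact X ->
  exists N : X -> set X,
    (forall a, K a -> open_nbhs a (N a)) /\
    forall q, K q -> exists v u, [/\ K v, K u &
      forall a y, K a -> N a q -> K y -> N a y -> (v <= y <= u)%O].
Proof.
move=> mX.
have lt_cotrans x y z : (x < z)%O -> (x < y)%O \/ (y < z)%O.
  move=> xz; have [|/not_lt_le yx] := pselect (x < y)%O; first by left.
  by right; exact: le_lt_trans xz.
have [|||||N [oN bN]] := @bounded_star _ (fun x y : X => (x < y)%O) K mX.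
- by move=> x; rewrite ltxx.
- by move=> x y z; exact: lt_trans.
- exact: lt_cotrans.
- exact: GO_open_ltr.
- exact: GO_open_gtr.
have [|||||M [oM bM]] := @bounded_star _ (fun x y : X => (y < x)%O) K mX.
- by move=> x; rewrite ltxx.
- by move=> x y z yx zy; exact: lt_trans yx.
- by move=> x y z zx; have [] := lt_cotrans _ y _ zx; [right|left].
- exact: GO_open_gtr.
- exact: GO_open_ltr.
exists (fun a => N a `&` M a); split=> [a Ka|q Kq].
  have [? ?] := oN _ Ka; have [? ?] := oM _ Ka.
  by split=> //; exact: openI.
have [u Ku uP] := bN _ Kq; have [v Kv vP] := bM _ Kq.
exists v, u; split=> // a y Ka [Nq Mq] Ky [Ny My].
by apply/andP; split; apply: not_lt_le; [exact: vP My|exact: uP Ny].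
Qed.

(* A convex member of [O] that meets [v, u] and leaves it contains the endpoint
   through which it leaves, so the bounded stars of [v] and [u] bound the next
   star ball. *)
Lemma hereditary_star_ball_bounded U (A : set X) (N : set X -> X -> set X)
    (O : set_type A -> set X) :
  (forall K q, K q -> exists v u, [/\ K v, K u &
    forall a y, K a -> N K a q -> K y -> N K a y -> (v <= y <= u)%O]) ->
  (forall a, [/\ order_convex (O a), O a (val a),
     O a `<=` N (finitely_linked U (val a)) (val a) &
     O a `<=` finitely_linked U (val a)]) ->
  forall n (x : set_type A), exists v u,
    [/\ finitely_linked U (val x) v, finitely_linked U (val x) u &
    forall y : set_type A,
      star_ball [set set_val @^-1` O a | a in [set: set_type A]] n x y ->
        (v <= val y <= u)%O].
Proof.
move=> bN OP n x; have [tot _ _] := GOX.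
elim: n => [|n [v [u [xv xu IHn]]]].
  have [_ Oxx _ OK] := OP x; have xx := OK _ Oxx.
  by exists (val x), (val x); split=> // _ ->; rewrite lexx.
have [v1 [u1 [xv1 xu1 uP]]] := bN _ _ xu.
have [v2 [u2 [xv2 xu2 vP]]] := bN _ _ xv.
have [v' [xv' v'v v'v2]] : exists v',
    [/\ finitely_linked U (val x) v', (v' <= v)%O & (v' <= v2)%O].
  by have /orP[?|?] := tot v v2; [exists v|exists v2].
have [u' [xu' uu' u1u']] : exists u',
    [/\ finitely_linked U (val x) u', (u <= u')%O & (u1 <= u')%O].
  by have /orP[?|?] := tot u u1; [exists u1|exists u].
exists v', u'; split=> // y [_ [[a _ <-] [p [ap /IHn /andP[vp pu]]]] ay].
have [convO Oaa ON OK] := OP a.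
(* [O a] lies within the class of [a], so meeting the class of [x] forces the two classes to
   coincide. *)
have same w : finitely_linked U (val x) w -> O a w ->
    finitely_linked U (val x) = finitely_linked U (val a).
  by move=> xw /OK aw; rewrite (finitely_linked_eq xw) (finitely_linked_eq aw).
apply/andP; split.
- have /orP[vy|yv] := tot v (val y); first exact: le_trans vy.
  have av : O a v by apply: convO ay ap _; rewrite yv.
  have xE := same _ xv av; rewrite -xE in ON OK.
  have xa : finitely_linked U (val x) (val a) by exact: OK.
  have /andP[v2y _] := vP _ _ xa (ON _ av) (OK _ ay) (ON _ ay).
  exact: le_trans v2y.
- have /orP[yu|uy] := tot (val y) u; first exact: le_trans yu uu'.
  have au : O a u by apply: convO ap ay _; rewrite pu.
  have xE := same _ xu au; rewrite -xE in ON OK.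
  have xa : finitely_linked U (val x) (val a) by exact: OK.
  have /andP[_ yu1] := uP _ _ xa (ON _ au) (OK _ ay) (ON _ ay).
  exact: le_trans yu1 u1u'.
Qed.

End GOSpace.

(** * Passage to subspaces *)

Lemma hausdorff_set_type (T : topologicalType) (A : set T) :
  hausdorff_space T -> hausdorff_space (set_type A).
Proof.
rewrite !open_hausdorff => hT x y xy.
have /hT[[B C] /= [xB yC] [oB oC /eqP BC]] : val x != val y by rewrite val_eqE.
exists (set_val @^-1` B, set_val @^-1` C).
  by rewrite !inE in xB yC *.
split; [by exists B|by exists C|].
by rewrite /= -preimage_setI BC preimage_set0.
Qed.

Theorem theorem1p2 (d : Order.disp_t) (X : POrderedTopological.type d)
    (hGO : GO_space X)
    (hX : monotonically_countably_metacompact X) :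
  hereditarily_paracompact X.
Proof.
move=> A; have [tot haus _] := hGO.
split=> [|W [oW coverW]]; first exact: hausdorff_set_type.
(* Linkage is formed in [X], where the bounded stars live: [U] consists of convex open sets of [X]
   whose traces on [A] refine [W]. It need not cover [X]. *)
pose U := [set C : set X | [/\ open C, order_convex C &
  exists2 B, W B & set_val @^-1` C `<=` (B : set (set_type A))]].
have [N NP] := boolp.choice (fun K : set X => GO_bounded_star hGO K hX).
(* Lying in [N] bounds the stars; lying in a member of [U] keeps [C] within the class of [a]. *)
have exO (a : set_type A) : exists C, [/\ open C, order_convex C, C (val a),
    C `<=` N (finitely_linked U (val a)) (val a) & exists2 D, U D & C `<=` D].
  have [B WB Ba] : cover W id a by rewrite coverW.
  have [B' oB' B'E] := oW _ WB.
  have aB' : B' (val a) by rewrite -B'E in Ba.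
  have [D [oD convD Da DB']] :=
    GO_convex_nbhs hGO (open_nbhs_nbhs (conj oB' aB')).
  have UD : U D by split=> //; exists B => //; rewrite -B'E => y; exact: DB'.
  have aa : finitely_linked U (val a) (val a).
    exact: (finitely_linked_convex UD convD).
  have [oN _] := NP (finitely_linked U (val a)).
  have aND : nbhs (val a) (N (finitely_linked U (val a)) (val a) `&` D).
    by apply: filterI; apply: open_nbhs_nbhs => //; exact: oN.
  have [C [oC convC Ca CND]] := GO_convex_nbhs hGO aND.
  by exists C; split=> // [y /CND[]//|]; exists D => // y /CND[].
have [O OP] := boolp.choice exO.
apply: (@star_finite_locally_finite_refinement _
  [set set_val @^-1` O a | a in [set: set_type A]]) => //.
  split=> [_ [a _ <-]|]; first by exists (O a) => //; have [] := OP a.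
  apply/seteqP; split=> // a _.
  by exists (set_val @^-1` O a); [exists a|have [] := OP a].
move=> n x.
have [|a|v [u [xv xu xP]]] :=
  @hereditary_star_ball_bounded _ _ hGO U A N O _ _ n x.
- by move=> K; have [] := NP K.
- have [_ convO Oa ON [D UD OD]] := OP a; split=> // y Oy.
  have [_ convD _] := UD.
  by apply: (finitely_linked_convex UD convD); exact: OD.
(* The ball lies between [v] and [u], which are linked through [x], so finitely many members of [U]
   cover it; each trace is then enlarged to a member of [W]. *)
have vx := finitely_linked_sym xv.
have [F [finF FU Fvu]] := finitely_linked_trans hGO vx xu.
have exB C : exists B, F C ->
    W B /\ set_val @^-1` C `<=` (B : set (set_type A)).
  have [FC|nFC] := pselect (F C); last by exists set0.
  by have [_ _ [B WB CB]] := FU _ FC; exists B.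
have [B BP] := boolp.choice exB.
exists (B @` F); split; first exact: finite_image.
  by move=> _ [C /BP[WB _] <-].
move=> y /xP vyu; have [|C FC Cy] := Fvu (val y); first by rewrite vyu.
by exists (B C); [exists C|have [_] := BP _ FC; apply].
Qed.
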